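(* Let $(U_i,U_i^0)$, $i\in[m]$, be real random variables and $\mathcal{H}_0\subset[m]$ a set of null indices. Define $G_i=\mathrm{sign}(U_i^0-U_i)\cdot[\exp(-U_i)\vee\exp(-U_i^0)]$, the threshold $$\tau=\inf\Big\{\lambda\in\{|G_i|\}_{i=1}^m:\frac{1+\sum_{i=1}^m\mathbb{I}(G_i\le-\lambda)}{\sum_{i=1}^m\mathbb{I}(G_i\ge\lambda)}\le\alpha\Big\}$$ ($\tau=\infty$ if empty) for a given $\alpha\in(0,1)$, and $e_i=\frac{m\,\mathbb{I}(G_i\ge\tau)}{1+\sum_{j=1}^m\mathbb{I}(G_j\le-\tau)}$. Let $p_i^{U,U^0}(u,v)$ be the conditional density (or mass function) of $(U_i,U_i^0)$ at $(u,v)$ given $(\mathbf{U}_{-i},\mathbf{U}^0_{-i})$, and $p_i^{U^0,U}(u,v)$ that of $(U_i^0,U_i)$ at $(u,v)$ given $(\mathbf{U}_{-i},\mathbf{U}^0_{-i})$, and define the observed KL divergence $\widehat{\mathrm{KL}}_i=\log\{p_i^{U,U^0}(U_i,U_i^0)/p_i^{U^0,U}(U_i,U_i^0)\}$. Then (a) $\mathbb{E}\big[\sum_{i\in\mathcal{H}_0}e_i\big]\le\inf_{\epsilon\ge0}\big\{m\big[e^{\epsilon}+\sum_{i\in\mathcal{H}_0}\mathbb{P}(\widehat{\mathrm{KL}}_i>\epsilon)\big]\big\}$; (b) if the $e$-BH procedure is applied to $e_1,\dots,e_m$ at level $\alpha$, i.e. rejecting $\{i:e_i\ge e_{(\hat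 k)}\}$ with $e_{(1)}\ge\dots\ge e_{(m)}$ and $\hat k=\max\{i:ie_{(i)}/m\ge1/\alpha\}$, its false discovery rate satisfies $\mathrm{FDR}\le\inf_{\epsilon\ge0}\big\{\alpha\big[e^{\epsilon}+\sum_{i\in\mathcal{H}_0}\mathbb{P}(\widehat{\mathrm{KL}}_i>\epsilon)\big]\big\}$.
   Context: For a rejection set $\mathcal{R}$, $\mathrm{FDR}=\mathbb{E}\big[|\mathcal{R}\cap\mathcal{H}_0|/\max\{|\mathcal{R}|,1\}\big]$. $\mathbf{U}_{-i}=(U_k:k\ne i)$, $\mathbf{U}^0_{-i}=(U^0_k:k\ne i)$. *)

(* Defs.v *)
From HB Require Import structures.
From mathcomp Require Import all_boot all_order all_algebra.
From mathcomp Require Import all_classical all_reals all_analysis.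
Set Implicit Arguments. Unset Strict Implicit. Unset Printing Implicit Defensive.
Import Order.TTheory GRing.Theory Num.Theory.
Local Open Scope classical_set_scope.
Local Open Scope ring_scope.

Section Defs.
Context {R : realType}.

Definition Gstat (u u0 : R) : R :=
  Num.sg (u0 - u) * Num.max (expR (- u)) (expR (- u0)).

Definition cnt_neg m (G : 'I_m -> R) (l : R) : nat := #|[set i | G i <= - l]|.
Definition cnt_pos m (G : 'I_m -> R) (l : R) : nat := #|[set i | l <= G i]|.

(* (1 + #neg) / #pos <= alpha ; a zero denominator is read as ratio = +oo *)
Definition knock_cond m (G : 'I_m -> R) (alpha l : R) : bool :=
  (0 < cnt_pos G l)%N && ((1 + (cnt_neg G l)%:R) / (cnt_pos G l)%:R <= alpha).

Definition tau m (G : 'I_m -> R) (alpha : R) : \bar R :=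
  ereal_inf [set (`|G i|)%:E | i in [set i | knock_cond G alpha `|G i|]].

Definition evals m (G : 'I_m -> R) (alpha : R) (i : 'I_m) : R :=
  let t := tau G alpha in
  m%:R * ((t <= (G i)%:E)%E : nat)%:R
    / (1 + (#|[set j | ((G j)%:E <= - t)%E]|)%:R).

Definition ebh_reject m (e : 'I_m -> R) (alpha : R) : {set 'I_m} :=
  let s := sort (fun x y => y <= x) [seq e i | i <- enum 'I_m] in
  let eo k := nth 0 s k.-1 in
  let ks := [seq k <- iota 1 m | alpha^-1 <= k%:R * eo k / m%:R] in
  if ks is [::] then finset.set0 else [set i | eo (foldr maxn 0%N ks) <= e i].

Definition fdp m (Rej H0 : {set 'I_m}) : R :=
  #|Rej :&: H0|%:R / (maxn #|Rej| 1)%:R.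

Definition sigma_rest d (T : measurableType d) m (U U0 : 'I_m -> T -> R)
  (i : 'I_m) : set (set T) :=
  <<s \bigcup_(j in [set j | j != i])
        (preimage_set_system setT (U j) measurable
         `|` preimage_set_system setT (U0 j) measurable) >>.

Definition is_cond_density d (T : measurableType d) (P : probability T R)
  (nu : {measure set R -> \bar R}) (S : set (set T)) (X Y : T -> R)
  (p : T -> R -> R -> R) : Prop :=
  [/\ (forall w u v, 0 <= p w u v),
      measurable_fun setT
        (fun x : g_sigma_algebraType S * (R * R) => p x.1 x.2.1 x.2.2) &
      (forall (C : set T) (B : set (R * R)), S C -> measurable B ->
        P (C `&` (fun w => (X w, Y w)) @^-1` B)
        = (\int[P]_(w in C) \int[(nu \x nu)%E]_(z in B) (p w z.1 z.2)%:E)%E)].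

(* observed KL: log( p(X,Y) / q(X,Y) ), with log(a/0) = +oo for a > 0
   and log(0/b) = -oo *)
Definition KLhat (T : Type) (p q : T -> R -> R -> R) (X Y : T -> R) (w : T)
  : \bar R :=
  let a := p w (X w) (Y w) in
  let b := q w (X w) (Y w) in
  if a == 0 then -oo%E else if b == 0 then +oo%E else (ln (a / b))%:E.

End Defs.

(* Main.v *)
(* Leave-one-out argument of the knockoff filter.  Write [G^i] for [G] with its
   [i]-th entry replaced by its absolute value, and let
   [s_i = 1{G^i selects i} / (1 + #{j <> i negatively selected by G^i})].
   If [G] selects [i] then [0 <= G i] and [G^i = G], so the normalized e-value
   [e_i / m] is at most [1{0 <= G i} s_i].  Exchanging [U i] and [U0 i] negates
   [G i] and fixes [G^i], so on the event where the density ratio is at most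
   [exp eps] the change of density gives
   [E[1{ratio <= exp eps, 0 <= G i} s_i] <= exp eps * E[1{G i <= 0} s_i]].
   Finally [sum_i 1{G i <= 0} s_i <= 1] pointwise: if [G^i] and [G^j] both select
   their flipped negative entries then they have the same threshold, so the
   denominator of [s_i] is at least the number of nonzero terms of the sum.  On
   the complementary event [e_i / m <= 1].  The e-BH bound follows from
   [FDP <= alpha / m * sum_i e_i].

   All statistics depend on [G] only through a finite table of comparisons; this
   gives measurability and turns the expectations above into finite sums. *)
Require Import Defs.
From HB Require Import structures.
From mathcomp Require Import all_boot all_order all_algebra.
From mathcomp Require Import all_classical all_reals all_analysis.
From mathcomp Require Import measurable_realfun.
Set Implicit Arguments.
Unset Strict Implicit.
Unset Printing Implicit Defensive.
Import Order.TTheory GRing.Theory Num.Theory.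
Local Open Scope classical_set_scope.
Local Open Scope ring_scope.

(** * Measurability with respect to a sub-sigma-algebra *)

Lemma measurable_fun_g_sigma_algebraType (d d' : measure_display)
    (T : measurableType d) (V : measurableType d') (S : set (set T)) (f : T -> V) :
  S `<=` measurable ->
  measurable_fun setT (f : g_sigma_algebraType S -> V) -> measurable_fun setT f.
Proof.
move=> SM mf _ B mB; have := mf measurableT B mB; rewrite !setTI.
by move: (f @^-1` B); apply: smallest_sub => //; exact: sigma_algebra_measurable.
Qed.

Lemma sigma_rest_measurable (R : realType) (d : measure_display) (T : measurableType d)
    (m : nat) (U U0 : 'I_m -> T -> R) (i : 'I_m) :
  (forall i, measurable_fun setT (U i)) -> (forall i, measurable_fun setT (U0 i)) ->
  sigma_rest U U0 i `<=` measurable.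
Proof.
move=> mU mU0; apply: smallest_sub; first exact: sigma_algebra_measurable.
by move=> A [j _] [] [B mB <-]; [exact: mU|exact: mU0].
Qed.

(** * Conditional densities and the change of density *)

Section cond_density.
Context (R : realType) (d : measure_display) (T : measurableType d).
Context (P : probability T R) (nu : {sigma_finite_measure set R -> \bar R}).
Context (S : set (set T)) (SS : sigma_algebra setT S) (SM : S `<=` measurable).
Context (X Y : T -> R) (mX : measurable_fun setT X) (mY : measurable_fun setT Y).
Context (p : T -> R -> R -> R) (dp : is_cond_density P nu S X Y p).

Let p0 w u v : 0 <= p w u v. Proof. by case: dp. Qed.

(** A version of the conditional probability, given [S], that [(w, (X w, Y w))] lies in [A]. The
    indicator multiplies the density, so that the integrand is jointly measurable in [(w, z)] and
    Tonelli applies. *)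
Definition cond_mass (A : set (g_sigma_algebraType S * (R * R))) (w : T) : \bar R :=
  (\int[(nu \x nu)%E]_z (p w z.1 z.2 * \1_A (w, z))%:E)%E.

Let Z := (g_sigma_algebraType S * (R * R))%type.

Let F (A : set (g_sigma_algebraType S * (R * R))) (x : g_sigma_algebraType S * (R * R)) :
  \bar R := (p x.1 x.2.1 x.2.2 * \1_A x)%:E.

Let measurable_integrand (A : set Z) : measurable A -> measurable_fun setT (F A).
Proof.
move=> mA; case: dp => _ mp _.
by apply/measurable_EFinP; apply: measurable_funM => //; exact: measurable_indic.
Qed.

Lemma measurable_cond_density_section (A : set Z) w : measurable A ->
  measurable_fun setT (fun z : R * R => F A (w, z)).
Proof.
move=> mA.
apply: (measurableT_comp (f := F A) (g := pair (w : g_sigma_algebraType S))).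
  exact: measurable_integrand.
exact: pair1_measurable.
Qed.

Lemma cond_mass_ge0 A w : (0 <= cond_mass A w)%E.
Proof. by apply: integral_ge0 => z _; rewrite lee_fin mulr_ge0. Qed.

(* By Tonelli over [nu] twice: the canonical sigma-finite structure of [nu \x nu]
   is found only for subprobability measures. *)
Lemma measurable_cond_mass (A : set Z) : measurable A -> measurable_fun setT (cond_mass A).
Proof.
move=> mA; apply: (@measurable_fun_g_sigma_algebraType _ _ _ _ S _ SM).
have F0 x : (0 <= F A x)%E by rewrite lee_fin mulr_ge0.
pose W := g_sigma_algebraType S.
pose H (wx : W * R) : \bar R := (\int[nu]_y F A (wx.1, (wx.2, y)))%E.
have mH : measurable_fun setT H.
  apply: (@measurable_fun_fubini_tonelli_F _ _ (W * R)%type R R nu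
    (fun x => F A (x.1.1, (x.1.2, x.2)))) => //.
  apply: (measurableT_comp (f := F A) (g := fun x : W * R * R => (x.1.1, (x.1.2, x.2)))).
    exact: measurable_integrand.
  apply: measurable_fun_pair; first exact: (measurableT_comp measurable_fst).
  by apply: measurable_fun_pair => //; exact: (measurableT_comp measurable_snd).
have := @measurable_fun_fubini_tonelli_F _ _ W R R nu H mH.
rewrite (_ : fubini_F nu H = cond_mass A); first by apply=> x; exact: integral_ge0.
apply/funext => w; rewrite /cond_mass (fubini_tonelli1 (fun z => F A (w, z)))//.
exact: measurable_cond_density_section.
Qed.

Let KX C B : S C -> measurable B -> (\int[P]_w cond_mass (C `*` B) w)%E =
  (\int[P]_(w in C) \int[(nu \x nu)%E]_(z in B) (p w z.1 z.2)%:E)%E.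
Proof.
move=> SC mB; rewrite [RHS]integral_mkcond; apply: eq_integral => w _.
rewrite /cond_mass patchE; case: ifPn => wC.
  rewrite [RHS]integral_mkcond; apply: eq_integral => z _.
  rewrite patchE indicE /=; case: ifPn => zB.
    by rewrite mem_set ?mulr1//; split; exact: set_mem.
  by rewrite memNset ?mulr0// => -[_ /= /mem_set]; rewrite (negbTE zB).
apply: integral0_eq => z _; rewrite indicE memNset ?mulr0// => -[/= /mem_set].
by rewrite (negbTE wC).
Qed.

Let J (w : T) : g_sigma_algebraType S * (R * R) := (w, (X w, Y w)).

Lemma measurable_joint (A : set Z) : measurable A -> measurable (J @^-1` A).
Proof.
move=> mA; rewrite -[_ @^-1` _]setTI.
have : measurable_fun setT J.
  apply: measurable_fun_pair; last exact: measurable_fun_pair.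
  exact: (@measurable_fun_g_sigma_algebraType _ _ _ _ S _ SM).
exact.
Qed.

(** [is_cond_density] gives this identity on rectangles only. Rectangles form a pi-system generating
    the product sigma-algebra, and the sets satisfying the identity form a Dynkin system. *)
Lemma cond_density_joint (A : set Z) :
  measurable A -> P (J @^-1` A) = (\int[P]_w cond_mass A w)%E.
Proof.
have K0 := cond_mass_ge0; case: dp => _ mp cp.
have ST : S setT by case: SS => S0 SC _; rewrite -(setD0 setT); exact: SC.
(* Total mass one is what closes the class under complement: the masses of [B] and of its complement
   add up to 1, and the finite mass of [B] cancels. *)
have KT : (\int[P]_w cond_mass setT w = 1)%E.
  rewrite -setXTT KX// -cp// setTI preimage_setT; exact: probability_setT.
rewrite measurable_prod_measurableType; move: A.
apply: dynkin_induction => /=.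
- by rewrite measurable_prod_measurableType.
- move=> _ _ [A1 mA1 [A2 mA2 <-]] [B1 mB1 [B2 mB2 <-]].
  exists (A1 `&` B1); first exact: measurableI.
  exists (A2 `&` B2); first exact: measurableI.
  by rewrite setXI.
- by rewrite preimage_setT KT; exact: probability_setT.
- move=> _ [C mC [B mB <-]].
  (* [mC] only places [C] in the sigma-algebra generated by [S], which is [S] itself. *)
  have SC : S C by move: mC; rewrite /measurable/= sigma_algebra_id.
  by rewrite KX// -cp.
- move=> B mB HB; rewrite preimage_setC probability_setC; last exact: measurable_joint.
  rewrite HB.
  have : (\int[P]_w cond_mass B w + \int[P]_w cond_mass (~` B) w = 1)%E.
    have mBC := measurableC mB.
    rewrite -ge0_integralD//; [|exact: (measurable_cond_mass mB)|exact: (measurable_cond_mass mBC)].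
    rewrite -KT; apply: eq_integral => w _; rewrite /cond_mass -ge0_integralD//.
    + apply: eq_integral => z _; rewrite -EFinD -mulrDr; congr (_ * _)%:E.
      by rewrite !indicE in_setT in_setC; case: (_ \in B); rewrite ?addr0 ?add0r.
    + by move=> z _; rewrite lee_fin mulr_ge0.
    + exact: measurable_cond_density_section.
    + by move=> z _; rewrite lee_fin mulr_ge0.
    + by apply: measurable_cond_density_section; exact: measurableC.
  move=> <-; rewrite addeC addeK// -HB fin_num_measure//; exact: measurable_joint.
- move=> E mE tE HE.
  rewrite preimage_bigcup measure_semi_bigcup//=; last 3 first.
  + by move=> n; exact: measurable_joint.
  + apply/trivIsetP => i j _ _ ij; rewrite -preimage_setI.
    by move/trivIsetP : tE => ->//; rewrite preimage_set0.
  + by apply: bigcup_measurable => n _; exact: measurable_joint.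
  under eq_eseriesr do rewrite HE.
  rewrite -integral_nneseries//; last by move=> n; exact: (measurable_cond_mass (mE n)).
  apply: eq_integral => w _; rewrite /cond_mass -integral_nneseries//; last 2 first.
  + by move=> n; exact: measurable_cond_density_section.
  + by move=> n z _; rewrite lee_fin mulr_ge0.
  apply: eq_integral => z _.
  by rewrite EFinM indic_bigcup// -nneseriesZl//; apply: eq_eseriesr => n _; rewrite EFinM.
Qed.

End cond_density.

(** Both probabilities integrate the conditional mass of the same [A], once with [p] and once with
    [q]. Exchanging [X] and [Y] leaves the first coordinate [w] alone, so the bound on densities
    over [A] integrates first in [z], then in [w]. *)
Lemma cond_density_ratio_le (R : realType) (d : measure_display) (T : measurableType d)
    (P : probability T R) (nu : {sigma_finite_measure set R -> \bar R})
    (S : set (set T)) (X Y : T -> R) (p q : T -> R -> R -> R) (c : R)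
    (A : set (g_sigma_algebraType S * (R * R))) :
  sigma_algebra setT S -> S `<=` measurable ->
  measurable_fun setT X -> measurable_fun setT Y ->
  is_cond_density P nu S X Y p -> is_cond_density P nu S Y X q -> 0 <= c ->
  measurable A -> (forall x, A x -> p x.1 x.2.1 x.2.2 <= c * q x.1 x.2.1 x.2.2) ->
  (P [set w | A (w, (X w, Y w))] <= c%:E * P [set w | A (w, (Y w, X w))])%E.
Proof.
move=> SS SM mX mY dp dq c0 mA pq.
rewrite (cond_density_joint SS SM mX mY dp mA) (cond_density_joint SS SM mY mX dq mA).
have p0 w u v : 0 <= p w u v by case: dp.
have q0 w u v : 0 <= q w u v by case: dq.
have mp := measurable_cond_mass SM dp mA; have mq := measurable_cond_mass SM dq mA.
rewrite -ge0_integralZl//; last by move=> w _; exact: (cond_mass_ge0 dq).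
apply: ge0_le_integral => //.
- by move=> w _; exact: (cond_mass_ge0 dp).
- exact: measurable_funeM.
move=> w _; rewrite /cond_mass -ge0_integralZl//; last 2 first.
- exact: (measurable_cond_density_section dq).
- by move=> z _; rewrite lee_fin mulr_ge0.
apply: ge0_le_integral => //.
- by move=> z _; rewrite lee_fin mulr_ge0.
- exact: (measurable_cond_density_section dp).
- by apply: measurable_funeM; exact: (measurable_cond_density_section dq).
move=> z _; rewrite -EFinM lee_fin indicE mulrA.
have [zA|] := boolP ((w, z) \in A); last by rewrite !mulr0.
by rewrite !mulr1; exact: pq (set_mem zA).
Qed.

(** * Knockoff statistics and leave-one-out scores *)

Lemma Gstat_swap (R : realType) (u v : R) : Gstat v u = - Gstat u v.
Proof. by rewrite /Gstat -opprB sgrN mulNr maxC. Qed.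

(** The two bits at [(i, k)] tell whether [cnt_neg] and [cnt_pos] count [i] at the level given by
    the absolute value of [G k]; candidate thresholds have no other form. *)
Definition cmp_table (R : realType) (m : nat) (G : 'I_m -> R) :
    {ffun 'I_m * 'I_m -> bool * bool} :=
  [ffun x => (G x.1 <= - `|G x.2|, `|G x.2| <= G x.1)].

(* [cnt_neg], [cnt_pos] and [evals] take cardinals of classical sets, not of
   finsets, because [Defs] opens [classical_set_scope]. *)
Lemma card_classical_set (T : finType) (p : pred T) : #|[set x | p x]| = #|[set x | p x]%SET|.
Proof. by apply: eq_card => x; rewrite finset.inE; apply/idP/idP => [/set_mem|/mem_set]. Qed.

Lemma cnt_negE (R : realType) (m : nat) (G : 'I_m -> R) l :
  cnt_neg G l = #|[set i | G i <= - l]%SET|.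
Proof. exact: card_classical_set. Qed.

Lemma cnt_posE (R : realType) (m : nat) (G : 'I_m -> R) l :
  cnt_pos G l = #|[set i | l <= G i]%SET|.
Proof. exact: card_classical_set. Qed.

Section scores.
Context (R : realType) (m : nat) (alpha : R).
Implicit Types (t : {ffun 'I_m * 'I_m -> bool * bool}) (G : 'I_m -> R).

Definition knock_tab t (k : 'I_m) : bool :=
  let pos := #|[set i | (t (i, k)).2]%SET| in
  (0 < pos)%N && ((1 + #|[set i | (t (i, k)).1]%SET|%:R) / pos%:R <= alpha).

Definition sel t (i : 'I_m) := [exists k, knock_tab t k && (t (i, k)).2].
Definition antisel t (i : 'I_m) := [exists k, knock_tab t k && (t (i, k)).1].

Definition escore t (i : 'I_m) : R :=
  (sel t i)%:R / (1 + #|[set j | antisel t j]%SET|%:R).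

(* At the table of [abs_at i G] this is the [s_i] of the header. *)
Definition loo_score t (i : 'I_m) : R :=
  (sel t i)%:R / (1 + #|[set j | (j != i) && antisel t j]%SET|%:R).

Lemma knock_tabE G k : knock_tab (cmp_table G) k = knock_cond G alpha `|G k|.
Proof.
rewrite /knock_tab /knock_cond cnt_posE cnt_negE.
have -> : #|[set i | (cmp_table G (i, k)).1]%SET| = #|[set i | G i <= - `|G k|]%SET|.
  by apply: eq_card => i; rewrite !inE ffunE.
have -> // : #|[set i | (cmp_table G (i, k)).2]%SET| = #|[set i | `|G k| <= G i]%SET|.
by apply: eq_card => i; rewrite !inE ffunE.
Qed.

(** The infimum runs over a finite set: it is attained, or the set is empty and [tau] is
    infinite. *)
Lemma tau_le G (x : R) : (tau G alpha <= x%:E)%E =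
  [exists k, knock_cond G alpha `|G k| && (`|G k| <= x)].
Proof.
apply/idP/existsP => [tx|[k /andP[Kk kx]]]; last first.
  by apply: (@le_trans _ _ (`|G k|)%:E); rewrite ?lee_fin//; apply: ereal_inf_lbound; exists k.
apply: contrapT => nK; move: tx; apply/negP; rewrite -ltNge.
(* The least admissible level, capped at [x + 1] so that it is a real number above [x] even when no
   level is admissible. *)
pose y := \big[Num.min/(x + 1)]_(k | knock_cond G alpha `|G k|) `|G k|.
apply: (@lt_le_trans _ _ y%:E).
  rewrite lte_fin; apply/bigmin_gtP; split=> [|k Kk]; first by rewrite ltrDl.
  by rewrite ltNge; apply/negP => kx; apply: nK; exists k; rewrite Kk.
by apply: le_ereal_inf_tmp => _ [k Kk <-]; rewrite lee_fin bigmin_le_cond.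
Qed.

Lemma tau_le_sel G i : (tau G alpha <= (G i)%:E)%E = sel (cmp_table G) i.
Proof. by rewrite tau_le; apply: eq_existsb => k; rewrite knock_tabE ffunE. Qed.

Lemma le_Ntau_antisel G j : ((G j)%:E <= - tau G alpha)%E = antisel (cmp_table G) j.
Proof.
rewrite leeNr -EFinN tau_le; apply: eq_existsb => k.
by rewrite knock_tabE ffunE /= lerNr.
Qed.

Lemma evalsE G i : evals G alpha i = m%:R * escore (cmp_table G) i.
Proof.
rewrite /evals /escore card_classical_set tau_le_sel mulrA.
by congr (_ / (1 + _%:R)); apply: eq_card => j; rewrite !inE le_Ntau_antisel.
Qed.

Lemma escore_ge0 t i : 0 <= escore t i.
Proof. by rewrite divr_ge0// addr_ge0. Qed.

Lemma loo_score_ge0 t i : 0 <= loo_score t i.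
Proof. by rewrite divr_ge0// addr_ge0. Qed.

Lemma escore_le1 t i : escore t i <= 1.
Proof.
rewrite ler_pdivrMr ?mul1r ?ltr_pwDl//.
by case: sel; rewrite ?addr_ge0// lerDl.
Qed.

Definition abs_at (i : 'I_m) G (j : 'I_m) : R := if j == i then `|G j| else G j.

Lemma norm_abs_at i G j : `|abs_at i G j| = `|G j|.
Proof. by rewrite /abs_at; case: ifP => // _; rewrite normr_id. Qed.

Lemma escore_le_loo G i :
  escore (cmp_table G) i <= (0 <= G i)%R%:R * loo_score (cmp_table (abs_at i G)) i.
Proof.
have [/existsP[k /andP[_]]|nsel] := boolP (sel (cmp_table G) i); last first.
  by rewrite {1}/escore (negbTE nsel) mul0r mulr_ge0 ?loo_score_ge0.
rewrite ffunE /= => kGi.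
have Gi0 : 0 <= G i by exact: le_trans kGi.
have -> : abs_at i G = G.
  by apply/funext => j; rewrite /abs_at; case: eqP => // ->; rewrite ger0_norm.
(* Leaving [j = i] out of the count can only shrink the denominator. *)
rewrite Gi0 mul1r ler_wpM2l// lef_pV2 ?posrE ?ltr_pwDl// lerD2l ler_nat.
by apply: subset_leq_card; apply/fintype.subsetP => j; rewrite !inE => /andP[].
Qed.

(** Isolates the only two indices at which [abs_at i G] and [abs_at j G] can differ. *)
Let card_sum (p : pred 'I_m) i j : i != j ->
  #|[set x | p x]%SET| = (p i + (p j + \sum_(x | (x != i) && (x != j)) p x))%N.
Proof.
by move=> ij; rewrite -sum1dep_card big_mkcond/= (bigD1 i)//= (bigD1 j) 1?eq_sym//=.
Qed.

(* From [abs_at j G] to [abs_at i G], entry [i] turns from negative to positive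
   and [j] from positive to negative, so neither count gets worse. *)
Lemma knock_cond_flip G i j (l : R) : 0 <= l -> i != j -> G i < - l -> G j <= - l ->
  knock_cond (abs_at j G) alpha l -> knock_cond (abs_at i G) alpha l.
Proof.
move=> l0 ij Gi Gj; have ji : j != i by rewrite eq_sym.
have ni : l < `|G i|.
  by rewrite ltrNr in Gi; apply: lt_le_trans Gi _; rewrite -normrN ler_norm.
have nj : l <= `|G j|.
  by rewrite lerNr in Gj; apply: le_trans Gj _; rewrite -normrN ler_norm.
(* The strict bound on [G i] excludes the tie [l = 0 = G i], at which [i] would count as positive on
   both sides. Index [j] may meet that tie, hence inequalities and not equalities between the
   counts. *)
have cp : (cnt_pos (abs_at j G) l <= cnt_pos (abs_at i G) l)%N.
  rewrite !cnt_posE !(card_sum _ ij) /abs_at !eqxx (negbTE ij) (negbTE ji).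
  rewrite (ltW ni) nj [l <= G i]leNgt.
  rewrite (lt_le_trans Gi)/= ?(le_trans _ l0) ?oppr_le0// add0n leq_add2l.
  rewrite -[leqLHS]add0n leq_add//; apply/eq_leq/eq_bigr => x /andP[/negbTE-> /negbTE->]//.
have cn : (cnt_neg (abs_at i G) l <= cnt_neg (abs_at j G) l)%N.
  rewrite !cnt_negE !(card_sum _ ij) /abs_at !eqxx (negbTE ij) (negbTE ji).
  rewrite (ltW Gi) Gj [`|G i| <= _]leNgt.
  rewrite (le_lt_trans _ (le_lt_trans l0 ni)) ?oppr_le0//= add0n.
  rewrite leq_add2l -[leqLHS]add0n leq_add//.
  apply/eq_leq/eq_bigr => x /andP[/negbTE-> /negbTE->]//.
rewrite /knock_cond => /andP[pj fj].
have pi := leq_trans pj cp; rewrite pi/=; apply: le_trans fj.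
by rewrite ler_pM ?invr_ge0 ?addr_ge0// ?lerD2l ?ler_nat// lef_pV2 ?posrE ?ltr0n ?ler_nat.
Qed.

Lemma sum_loo_score_le1 G (H0 : {set 'I_m}) :
  \sum_(i in H0) (G i <= 0)%R%:R * loo_score (cmp_table (abs_at i G)) i <= 1.
Proof.
(* [N] indexes the nonzero terms; each of them will be at most the inverse of the cardinal of
   [N]. *)
pose N := [set i | (G i <= 0) && sel (cmp_table (abs_at i G)) i]%SET.
have selP i : i \in N ->
    exists2 k, knock_cond (abs_at i G) alpha `|G k| & G i <= - `|G k|.
  rewrite inE => /andP[Gi0 /existsP[k]]; rewrite knock_tabE ffunE/= !norm_abs_at.
  by rewrite /abs_at eqxx (ler0_norm Gi0) => /andP[Kk ?]; exists k; rewrite // lerNr.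
(* The smaller of the two selecting levels serves as witness. If it is the one of [j], then [G i]
   lies strictly below its opposite, and [knock_cond_flip] carries admissibility from [abs_at j G]
   to [abs_at i G]. *)
have NP i j : i \in N -> j \in N -> j != i -> antisel (cmp_table (abs_at i G)) j.
  move=> /selP[k Kk Gik] /selP[l Kl Gjl] ji.
  have wit h : knock_cond (abs_at i G) alpha `|G h| -> G j <= - `|G h| ->
      antisel (cmp_table (abs_at i G)) j.
    move=> Kh Gjh; apply/existsP; exists h.
    by rewrite knock_tabE ffunE/= !norm_abs_at Kh /abs_at (negbTE ji).
  have [kl|lk] := leP `|G k| `|G l|.
    by apply: (wit k) => //; apply: le_trans Gjl _; rewrite lerN2.
  apply: (wit l) => //; apply: knock_cond_flip Kl => //; first by rewrite eq_sym.
  by apply: le_lt_trans Gik _; rewrite ltrN2.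
have le1 i : (G i <= 0)%R%:R * loo_score (cmp_table (abs_at i G)) i <=
    (i \in N)%:R / #|N|%:R.
  have [iN|] := boolP (i \in N); last first.
    rewrite inE negb_and => /orP[/negbTE->|/negbTE nsel]; first by rewrite !mul0r.
    by rewrite /loo_score nsel !mul0r mulr0.
  have := iN; rewrite inE => /andP[-> si]; rewrite /loo_score si !mul1r.
  have N0 : (0 < #|N|)%N by apply/card_gt0P; exists i.
  rewrite lef_pV2 ?posrE ?ltr_pwDl ?ltr0n//.
  (* The 1 in the denominator accounts for [i] itself, the antiselected indices for the rest of
     [N]. *)
  rewrite (cardsD1 i N) iN natrD lerD2l ler_nat; apply: subset_leq_card.
  apply/fintype.subsetP => j; rewrite in_setD1 => /andP[ji jN].
  by rewrite inE ji NP.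
apply: (@le_trans _ _ (\sum_(i in H0) (i \in N)%:R / #|N|%:R)).
  exact: ler_sum.
apply: (@le_trans _ _ (\sum_i (i \in N)%:R / #|N|%:R)).
  rewrite [leRHS](bigID (mem H0))/= lerDl; apply: sumr_ge0 => i _.
  by rewrite divr_ge0.
rewrite -mulr_suml -natr_sum -big_mkcond/= sum1_card.
(* For empty [N] the quotient is 0, the inverse of 0 being 0. *)
by have [->|N0] := eqVneq #|N| 0%N; rewrite ?mul0r// divff// pnatr_eq0.
Qed.

End scores.

(** * The e-BH procedure *)

Lemma count_sorted_ge (R : realType) (s : seq R) (k : nat) :
  (0 < k <= size s)%N ->
  (k <= count (fun x => (nth 0 (sort (fun x y : R => y <= x) s) k.-1 <= x)%R) s)%N.
Proof.
move=> /andP[k0 ks]; set r := fun x y : R => y <= x; set o := sort r s.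
have so : sorted r o by apply: sort_sorted => x y; exact: le_total.
have sz : size o = size s by rewrite size_sort.
rewrite -(permP (permEl (perm_sort r s))) -/o.
(* The first [k] entries of the decreasing list already reach its [k]-th value, which sits at
   position [k.-1]; ties can only add to the count. *)
rewrite -[in X in count _ X](cat_take_drop k o) count_cat.
suff /eqP-> : count (fun x => nth 0 o k.-1 <= x) (take k o) == size (take k o).
  by rewrite size_take_min sz (minn_idPl ks) leq_addr.
rewrite -all_count; apply/(all_nthP 0) => h; rewrite size_take_min sz (minn_idPl ks) => hk.
rewrite nth_take//=.
apply: (sorted_leq_nth _ _ 0 so); rewrite ?inE ?sz ?prednK//.
- by move=> a b c ba cb; exact: le_trans ba.
- by move=> a; exact: lexx.
- exact: leq_trans hk ks.
- by rewrite -ltnS prednK.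
Qed.

(** With [kh] the e-BH index, a rejected [e i] is at least [m / (alpha * kh)], and at least [kh]
    indices are rejected. So each rejected null contributes at most [alpha * e i / m] to the
    proportion. *)
Lemma fdp_ebh_le (R : realType) (m : nat) (e : 'I_m -> R) (alpha : R) (H0 : {set 'I_m}) :
  0 < alpha -> (forall i, 0 <= e i) ->
  fdp (ebh_reject e alpha) H0 <= alpha / m%:R * \sum_(i in H0) e i.
Proof.
move=> a0 e0.
have rhs0 : 0 <= alpha / m%:R * \sum_(i in H0) e i.
  by apply: mulr_ge0; [rewrite divr_ge0// ltW|exact: sumr_ge0].
rewrite /fdp /ebh_reject; cbv zeta; set s := sort _ _; set ks := [seq _ <- _ | _].
case: (@eqP _ ks [::]) => [->|/eqP ksN]; first by rewrite finset.set0I cards0 mul0r.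
set kh := foldr maxn 0%N ks; set Rej := (X in #|X :&: _|); rewrite -/Rej.
have RejE : Rej = [set i | nth 0 s kh.-1 <= e i]%SET by rewrite /Rej /kh; case: (ks) ksN.
(* The maximum of a nonempty list belongs to it; the default 0 of the fold is absorbed. *)
have khin : kh \in ks.
  rewrite /kh; elim: (ks) ksN => // x [|y l] IH _; first by rewrite /= maxn0 mem_head.
  have := IH isT; rewrite -[foldr _ _ (x :: _)]/(maxn x (foldr maxn 0%N (y :: l))).
  rewrite [in X in _ -> X]in_cons; move: (foldr _ _ (y :: l)) => M Ml.
  by case: (leqP x M) => _; rewrite ?Ml ?eqxx ?orbT.
move: khin; rewrite mem_filter mem_iota add1n ltnS => /andP[hk /andP[k0 km]].
have cRej : (kh <= #|Rej|)%N.
  have := @count_sorted_ge R [seq e i | i <- enum 'I_m] kh.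
  rewrite size_map size_enum_ord k0 km => /(_ isT) /leq_trans; apply.
  rewrite count_map RejE cardE -size_filter; apply/eq_leq; congr size.
  by rewrite /enum_mem -filter_predI; apply: eq_filter => i; rewrite !inE/= andbT.
have R0 : (0 < #|Rej|)%N by exact: leq_trans cRej.
have m0 : 0 < m%:R :> R by rewrite ltr0n (leq_trans k0).
rewrite (maxn_idPl R0) mulr_sumr.
have -> : #|Rej :&: H0|%:R = \sum_(i in H0) (i \in Rej)%:R :> R.
  rewrite -natr_sum -sum1_card big_mkcond [in RHS]big_mkcond/=; congr _%:R.
  by apply: eq_bigr => i _; rewrite inE andbC; case: (i \in H0); case: (i \in Rej).
rewrite mulr_suml; apply: ler_sum => i _.
have [iR|_] := boolP (i \in Rej); last by rewrite mul0r mulr_ge0// divr_ge0// ltW.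
have ei : nth 0 s kh.-1 <= e i by move: iR; rewrite RejE inE.
have kR : 0 < kh%:R :> R by rewrite ltr0n.
rewrite mul1r; apply: (@le_trans _ _ kh%:R^-1).
  by rewrite lef_pV2 ?posrE ?ltr0n// ler_nat.
rewrite mulrAC ler_pdivlMr// ler_pdivrMl// mulrCA -ler_pdivrMl//.
apply: (le_trans (y := kh%:R * nth 0 s kh.-1)); last by rewrite ler_wpM2l// ltW.
by move: hk; rewrite ler_pdivlMr.
Qed.

(** * Integration of functions of a finite-valued map, and measurability of the statistics *)

Section fin_valued.
Context (R : realType) (d : measure_display) (T : measurableType d) (F : finType).
Context (t : T -> F) (mt : forall a, measurable (t @^-1` [set a])).

Lemma measurable_fun_fin_valued (d' : measure_display) (V : measurableType d') (f : F -> V) :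
  measurable_fun setT (f \o t).
Proof.
move=> _ B mB; rewrite setTI (_ : _ @^-1` B = \bigcup_(a in f @^-1` B) t @^-1` [set a]).
  by apply: fin_bigcup_measurable => //; exact: finite_finset.
apply/seteqP; split=> [w Bw|w [a Ba ta]]; first by exists (t w).
by rewrite /= ta.
Qed.

(** Splitting along the fibres of [t] leaves only probabilities of events, to which the change of
    density applies one fibre at a time. *)
Lemma integral_fin_valued_indic (P : {measure set T -> \bar R}) (f : F -> R) (E : set T) :
  measurable E -> (forall a, 0 <= f a) ->
  (\int[P]_w (f (t w) * \1_E w)%:E = \sum_a (f a)%:E * P (t @^-1` [set a] `&` E))%E.
Proof.
move=> mE f0; have mtE a : measurable (t @^-1` [set a] `&` E) by exact: measurableI.
transitivity (\int[P]_w (\sum_a (f a)%:E * (\1_(t @^-1` [set a] `&` E) w)%:E))%E.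
  apply: eq_integral => w _; rewrite (bigD1 (t w))//= big1 ?adde0.
    rewrite -EFinM !indicE in_setI; congr (_ * _%:R)%:E.
    by have -> : w \in t @^-1` [set t w] by apply: mem_set.
  move=> a /negbTE at_; rewrite indicE memNset ?mule0// => -[/= tw _].
  by rewrite tw eqxx in at_.
rewrite ge0_integral_sum//.
- apply: eq_bigr => a _; rewrite ge0_integralZl ?lee_fin//.
    by rewrite integral_indic// setIT.
  by apply/measurable_EFinP; exact: measurable_indic.
- by move=> a; apply: measurable_funeM; apply/measurable_EFinP; exact: measurable_indic.
- by move=> a w _; rewrite -EFinM lee_fin mulr_ge0.
Qed.

End fin_valued.

Lemma emeasurable_sum_in (R : realType) (d : measure_display) (T : measurableType d)
    (I : finType) (A : {set I}) (f : I -> T -> \bar R) :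
  (forall i, measurable_fun setT (f i)) ->
  measurable_fun setT (fun w => \sum_(i in A) f i w)%E.
Proof. by move=> mf; under eq_fun do rewrite -big_enum; exact: emeasurable_sum. Qed.

Lemma ge0_integral_sum_in (R : realType) (d : measure_display) (T : measurableType d)
    (I : finType) (mu : {measure set T -> \bar R}) (A : {set I}) (f : I -> T -> \bar R) :
  (forall i, measurable_fun setT (f i)) -> (forall i w, (0 <= f i w)%E) ->
  (\int[mu]_w \sum_(i in A) f i w = \sum_(i in A) \int[mu]_w f i w)%E.
Proof.
move=> mf f0; rewrite -big_enum -ge0_integral_sum//.
by apply: eq_integral => w _; rewrite big_enum.
Qed.

Lemma measurable_Gstat (R : realType) (d : measure_display) (T : measurableType d)
    (u v : T -> R) :
  measurable_fun setT u -> measurable_fun setT v ->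
  measurable_fun setT (fun w => Gstat (u w) (v w)).
Proof.
move=> mu mv.
(* The sign is rewritten as nested order tests, whose measurability is available. *)
have -> : (fun w => Gstat (u w) (v w)) =
    (fun w => (if u w < v w then 1 else if v w < u w then -1 else 0) *
      Num.max (expR (- u w)) (expR (- v w))).
  apply/funext => w; rewrite /Gstat; congr (_ * _).
  case: ltgtP => [uv|vu|->]; last by rewrite subrr sgr0.
    by rewrite gtr0_sg// subr_gt0.
  by rewrite ltr0_sg// subr_lt0.
apply: measurable_funM.
  apply: measurable_fun_ifT => //; first exact: measurable_fun_ltr.
  by apply: measurable_fun_ifT => //; exact: measurable_fun_ltr.
have me (f : T -> R) : measurable_fun setT f -> measurable_fun setT (fun w => expR (- f w)).
  by move=> mf; apply: measurableT_comp => //; exact: measurableT_comp.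
by apply: measurable_maxr; exact: me.
Qed.

Lemma measurable_cmp_table (R : realType) (d : measure_display) (T : measurableType d)
    (m : nat) (H : T -> 'I_m -> R) :
  (forall j, measurable_fun setT (H ^~ j)) ->
  forall a, measurable ((fun w => cmp_table (H w)) @^-1` [set a]).
Proof.
move=> mH a.
rewrite (_ : _ @^-1` _ = \bigcap_(x in [set: 'I_m * 'I_m])
  ((fun w => H w x.1 <= - `|H w x.2|) @^-1` [set (a x).1] `&`
   (fun w => `|H w x.2| <= H w x.1) @^-1` [set (a x).2])).
  apply: fin_bigcap_measurable => [|x _]; first exact: finite_finset.
  have mn : measurable_fun setT (fun w => `|H w x.2|).
    exact: (measurableT_comp (normr_measurable (D := setT))).
  apply: measurableI; rewrite -[X in measurable X]setTI.
    by apply: measurable_fun_ler => //; exact: measurableT_comp.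
  exact: measurable_fun_ler.
apply/seteqP; split => [w ta x _|w aw].
  by rewrite /= -ta ffunE.
apply/ffunP => x; rewrite ffunE; have [/= -> ->] := aw x Logic.I.
by rewrite -surjective_pairing.
Qed.

(** Clears the logarithm and the quotient. The conventions for vanishing densities agree with the
    product form: [p = 0] makes both sides false, and [q = 0 < p] makes both true. *)
Lemma lt_KLhat (R : realType) (T : Type) (p q : T -> R -> R -> R) (X Y : T -> R) w eps :
  0 <= p w (X w) (Y w) -> 0 <= q w (X w) (Y w) ->
  (eps%:E < KLhat p q X Y w)%E = (expR eps * q w (X w) (Y w) < p w (X w) (Y w)).
Proof.
rewrite /KLhat; set a := p _ _ _; set b := q _ _ _ => a0 b0.
have [->|an0] := eqVneq a 0; first by rewrite ltNge leNye/= ltNge mulr_ge0 ?expR_ge0.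
have ap : 0 < a by rewrite lt_neqAle eq_sym an0.
have [->|bn0] := eqVneq b 0; first by rewrite mulr0 ap ltry.
have bp : 0 < b by rewrite lt_neqAle eq_sym bn0.
by rewrite lte_fin -[eps < _]ltr_expR lnK ?posrE ?divr_gt0// ltr_pdivlMr.
Qed.

(** * Exchanging [U i] and [U0 i] under the joint law *)

Section robust_knockoff.
Context (R : realType) (d : measure_display) (T : measurableType d).
Context (P : probability T R) (m : nat) (U U0 : 'I_m -> T -> R) (alpha : R).
Context (nu : {sigma_finite_measure set R -> \bar R}) (p q : 'I_m -> T -> R -> R -> R).
Context (mU : forall i, measurable_fun setT (U i)).
Context (mU0 : forall i, measurable_fun setT (U0 i)).
Context (dp : forall i, is_cond_density P nu (sigma_rest U U0 i) (U i) (U0 i) (p i)).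
Context (dq : forall i, is_cond_density P nu (sigma_rest U U0 i) (U0 i) (U i) (q i)).

Let G (w : T) (i : 'I_m) := Gstat (U i w) (U0 i w).

Let tab i w := cmp_table (abs_at i (G w)).

Let mG i : measurable_fun setT (G ^~ i).
Proof. exact: measurable_Gstat. Qed.

Let mtab i a : measurable (tab i @^-1` [set a]).
Proof.
apply: measurable_cmp_table => j; rewrite /abs_at; case: (j == i) => //.
exact: (measurableT_comp (normr_measurable (D := setT))).
Qed.

Let mjoint i : measurable_fun setT
  (fun w => (w, (U i w, U0 i w)) : g_sigma_algebraType (sigma_rest U U0 i) * (R * R)).
Proof.
apply: measurable_fun_pair; last exact: measurable_fun_pair.
apply: (@measurable_fun_g_sigma_algebraType _ _ _ _ (sigma_rest U U0 i)) => //.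
exact: sigma_rest_measurable.
Qed.

Lemma sigma_rest_coord i j : j != i ->
  measurable_fun setT (U j : g_sigma_algebraType (sigma_rest U U0 i) -> R) /\
  measurable_fun setT (U0 j : g_sigma_algebraType (sigma_rest U U0 i) -> R).
Proof.
(* Two generation steps: the sigma-algebra carried by the type, and [sigma_rest] itself. *)
move=> ji; split=> _ B mB; apply: sub_sigma_algebra; apply: sub_sigma_algebra;
  exists j => //; [left|right]; by exists B.
Qed.

Let E (c : R) i := [set w | p i w (U i w) (U0 i w) <= c * q i w (U i w) (U0 i w)].

Lemma measurable_ratio c i : measurable (E c i).
Proof.
case: (dp i) (dq i) => _ mp _ [_ mq _].
rewrite -[X in measurable X]setTI; apply: measurable_fun_le => //.
  exact: (measurableT_comp mp (@mjoint i)).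
apply: measurable_funM => //; exact: (measurableT_comp mq (@mjoint i)).
Qed.

Lemma loo_score_swap_le c i : 0 <= c ->
  (\int[P]_w (loo_score alpha (tab i w) i * \1_(E c i `&` [set w | 0 <= G w i]) w)%:E <=
   c%:E * \int[P]_w (loo_score alpha (tab i w) i * \1_([set w | G w i <= 0]) w)%:E)%E.
Proof.
move=> c0.
have mpos : measurable [set w | 0 <= G w i].
  by rewrite -[X in measurable X]setTI; apply: measurable_fun_le.
have mneg : measurable [set w | G w i <= 0].
  by rewrite -[X in measurable X]setTI; apply: measurable_fun_le.
rewrite !(integral_fin_valued_indic (mtab i) _ (f := fun a => loo_score alpha a i))//;
  do ?[by apply: measurableI => //; exact: measurable_ratio|by move=> a; exact: loo_score_ge0].
rewrite ge0_sume_distrr => [|a _]; last by rewrite mule_ge0// lee_fin loo_score_ge0.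
apply: lee_sum => a _; rewrite muleCA lee_wpmul2l ?lee_fin ?loo_score_ge0//.
pose W := g_sigma_algebraType (sigma_rest U U0 i).
(* [H] rebuilds [abs_at i G] on the product space, entry [i] from the pair and the others from [w]
   through [sigma_rest]. The absolute value makes it agree at both orders of the pair ([HU],
   [HU0]). *)
pose H (x : W * (R * R)) (j : 'I_m) :=
  if j == i then `|Gstat x.2.1 x.2.2| else Gstat (U j x.1) (U0 j x.1).
have HU w : H (w, (U i w, U0 i w)) = abs_at i (G w).
  by apply/funext => j; rewrite /H /abs_at; case: eqP => // ->.
have HU0 w : H (w, (U0 i w, U i w)) = abs_at i (G w).
  by apply/funext => j; rewrite /H /abs_at; case: eqP => // ->; rewrite Gstat_swap normrN.
have mGz : measurable_fun setT (fun x : W * (R * R) => Gstat x.2.1 x.2.2).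
  by apply: measurable_Gstat; exact: (measurableT_comp _ measurable_snd).
have mH j : measurable_fun setT (H ^~ j).
  rewrite /H; have [_|ji] := eqVneq j i.
    exact: (measurableT_comp (normr_measurable (D := setT))).
  have [mUj mU0j] := sigma_rest_coord ji.
  by apply: measurable_Gstat; [exact: (measurableT_comp mUj measurable_fst)|
    exact: (measurableT_comp mU0j measurable_fst)].
pose A := [set x : W * (R * R) | cmp_table (H x) = a] `&`
  ([set x | p i x.1 x.2.1 x.2.2 <= c * q i x.1 x.2.1 x.2.2] `&`
   [set x | 0 <= Gstat x.2.1 x.2.2]).
have mA : measurable A.
  apply: measurableI; first exact: measurable_cmp_table.
  case: (dp i) (dq i) => _ mp _ [_ mq _].
  apply: measurableI; rewrite -[X in measurable X]setTI; apply: measurable_fun_le => //.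
  exact: measurable_funM.
have Apq x : A x -> p i x.1 x.2.1 x.2.2 <= c * q i x.1 x.2.1 x.2.2 by case=> _ [].
have := cond_density_ratio_le (smallest_sigma_algebra _ _)
  (sigma_rest_measurable mU mU0) (mU i) (mU0 i) (dp i) (dq i) c0 mA Apq.
rewrite (_ : [set w | A (w, (U i w, U0 i w))] =
  tab i @^-1` [set a] `&` (E c i `&` [set w | 0 <= G w i])); last first.
  by apply/seteqP; split=> w; rewrite /A /tab/= HU.
move=> /le_trans; apply; apply: lee_wpmul2l; first by rewrite lee_fin.
(* At the exchanged pair, [0 <= Gstat] turns into [G w i <= 0]; the ratio constraint is dropped. *)
apply: le_measure; rewrite ?inE.
- exact: (measurable_joint (sigma_rest_measurable mU mU0) (mU0 i) (mU i) mA).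
- exact: measurableI.
move=> w; rewrite /A /tab/= HU0 => -[ta [_]]; split => //.
by rewrite /= /G -oppr_ge0 -Gstat_swap.
Qed.

Lemma measurable_cmp_tableG a : measurable ((fun w => cmp_table (G w)) @^-1` [set a]).
Proof. exact: measurable_cmp_table. Qed.

Lemma integral_escore_le eps (H0 : {set 'I_m}) :
  (\int[P]_w (\sum_(i in H0) escore alpha (cmp_table (G w)) i)%:E <=
   (expR eps)%:E +
   \sum_(i in H0) P [set w | (eps%:E < KLhat (p i) (q i) (U i) (U0 i) w)%E])%E.
Proof.
set c := expR eps; have c0 : 0 <= c by exact: expR_ge0.
have mpos i : measurable [set w | 0 <= G w i].
  by rewrite -[X in measurable X]setTI; apply: measurable_fun_le.
have mneg i : measurable [set w | G w i <= 0].
  by rewrite -[X in measurable X]setTI; apply: measurable_fun_le.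
have mE i := measurable_ratio c i; have mEC i := measurableC (mE i).
have KLE i : [set w | (eps%:E < KLhat (p i) (q i) (U i) (U0 i) w)%E] = ~` E c i.
  case: (dp i) (dq i) => p0 _ _ [q0 _ _]; apply/seteqP; split=> w /=;
  by rewrite lt_KLhat// ltNge => /negP.
have mloo i : measurable_fun setT (fun w => loo_score alpha (tab i w) i).
  exact: (measurable_fun_fin_valued (@mtab i) (fun a => loo_score alpha a i)).
have mloo1 i B : measurable B ->
    measurable_fun setT (fun w => (loo_score alpha (tab i w) i * \1_B w)%:E).
  by move=> mB; apply/measurable_EFinP; apply: measurable_funM => //; exact: measurable_indic.
have loo1_ge0 i B w : (0 <= (loo_score alpha (tab i w) i * \1_B w)%:E)%E.
  by rewrite lee_fin mulr_ge0 ?loo_score_ge0.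
(* Pointwise majorant of [escore]: the trivial bound 1 off [E c i], the leave-one-out score on
   it. *)
pose f i w := ((\1_(~` E c i) w)%:E +
  (loo_score alpha (tab i w) i * \1_(E c i `&` [set w | (0 <= G w i)%R]) w)%:E)%E.
have m1 i : measurable_fun setT (fun w => (\1_(~` E c i) w)%:E : \bar R).
  by apply/measurable_EFinP; exact: measurable_indic.
have mf i : measurable_fun setT (f i).
  by apply: emeasurable_funD => //; apply: mloo1; exact: measurableI.
have f0 i w : (0 <= f i w)%E by rewrite adde_ge0// lee_fin.
apply: (@le_trans _ _ (\int[P]_w \sum_(i in H0) f i w)%E).
  apply: ge0_le_integral => //.
  - by move=> w _; rewrite lee_fin sumr_ge0// => i _; exact: escore_ge0.
  - exact: (measurable_fun_fin_valued measurable_cmp_tableG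
      (fun a => (\sum_(i in H0) escore alpha a i)%:E)).
  - exact: emeasurable_sum_in.
  move=> w _; rewrite -sumEFin; apply: lee_sum => i _.
  rewrite /f -EFinD lee_fin !indicE in_setC in_setI.
  have [wE|wE] := boolP (w \in E c i); last first.
    by rewrite mulr0 addr0; exact: escore_le1.
  rewrite add0r; apply: le_trans (escore_le_loo _ _ _) _; rewrite mulrC.
  by rewrite (_ : (w \in [set w | 0 <= G w i]) = (0 <= G w i))//; apply: asboolb.
rewrite ge0_integral_sum_in// addeC.
under eq_bigr => i _.
  rewrite ge0_integralD//; last first.
    by apply: mloo1; exact: measurableI.
  rewrite integral_indic// setIT -KLE.
  over.
rewrite big_split/= leeD2l//.
apply: (@le_trans _ _ (\sum_(i in H0)
   c%:E * \int[P]_w (loo_score alpha (tab i w) i * \1_[set w | G w i <= 0] w)%:E)%E).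
  by apply: lee_sum => i _; exact: loo_score_swap_le.
rewrite -ge0_sume_distrr; last by move=> i _; exact: integral_ge0.
rewrite -ge0_integral_sum_in//; last by move=> i; exact: mloo1.
(* It remains to bound the expected sum of scores over [G w i <= 0] by 1, which holds pointwise. *)
rewrite -[leRHS]mule1; apply: lee_wpmul2l; first by rewrite lee_fin.
have <- : (\int[P]_w (cst 1%E w) = 1)%E by rewrite integral_cst// mul1e; exact: probability_setT.
apply: ge0_le_integral => //.
- by move=> w _; exact: sume_ge0.
- by apply: emeasurable_sum_in => i; exact: mloo1.
move=> w _; rewrite sumEFin lee_fin.
apply: le_trans (sum_loo_score_le1 alpha (G w) H0).
apply: ler_sum => i _; rewrite mulrC ler_wpM2r ?loo_score_ge0// indicE.
by rewrite (_ : (w \in [set w | G w i <= 0]) = (G w i <= 0))//; apply: asboolb.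
Qed.

End robust_knockoff.

(** * Bounds on the expected null e-values and on the FDR *)

Theorem theorem3 (R : realType) (d : measure_display) (T : measurableType d)
  (P : probability T R) (m : nat) (U U0 : 'I_m -> T -> R) (H0 : {set 'I_m})
  (alpha : R) (nu : {sigma_finite_measure set R -> \bar R})
  (p q : 'I_m -> T -> R -> R -> R) :
  (forall i, measurable_fun setT (U i)) ->
  (forall i, measurable_fun setT (U0 i)) ->
  0 < alpha < 1 ->
  (forall i, is_cond_density P nu (sigma_rest U U0 i) (U i) (U0 i) (p i)) ->
  (forall i, is_cond_density P nu (sigma_rest U U0 i) (U0 i) (U i) (q i)) ->
  let G := fun w (i : 'I_m) => Gstat (U i w) (U0 i w) in
  let e := fun w => evals (G w) alpha in
  let bound := fun c : \bar R =>
    ereal_inf [set (c * ((expR eps)%:E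
        + \sum_(i in H0) P [set w | (eps%:E < KLhat (p i) (q i) (U i) (U0 i) w)%E]))%E
      | eps in [set eps : R | 0 <= eps]] in
  ((\int[P]_w (\sum_(i in H0) e w i)%:E <= bound (m%:R)%:E)%E /\
   (\int[P]_w (fdp (ebh_reject (e w) alpha) H0)%:E <= bound alpha%:E)%E).
Proof.
move=> mU mU0 /andP[a0 _] dp dq G e bound.
(* As functions of the finite table, the e-values and the e-BH proportion are measurable. *)
have eE w : e w = fun i => m%:R * escore alpha (cmp_table (G w)) i.
  by apply/funext => i; exact: evalsE.
have mtab := measurable_cmp_tableG mU mU0.
pose s w := (\sum_(i in H0) escore alpha (cmp_table (G w)) i)%:E : \bar R.
have s0 w : (0 <= s w)%E by rewrite lee_fin sumr_ge0// => i _; exact: escore_ge0.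
have ms : measurable_fun setT s.
  exact: (measurable_fun_fin_valued mtab (fun a => (\sum_(i in H0) escore alpha a i)%:E)).
have main eps := integral_escore_le alpha mU mU0 dp dq eps H0.
split; apply: le_ereal_inf_tmp => _ [eps _ <-].
  rewrite (_ : (\int[P]_w _ = m%:R%:E * \int[P]_w s w)%E).
    by apply: lee_wpmul2l; [rewrite lee_fin|exact: main].
  rewrite -ge0_integralZl ?lee_fin//; apply: eq_integral => w _.
  by rewrite eE -mulr_sumr EFinM.
(* [s] is the null e-value sum divided by [m], so both claims reduce to [main]. *)
apply: (@le_trans _ _ (alpha%:E * \int[P]_w s w)%E); last first.
  by apply: lee_wpmul2l; [rewrite lee_fin ltW|exact: main].
rewrite -ge0_integralZl ?lee_fin ?(ltW a0)//; apply: ge0_le_integral => //.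
- by move=> w _; rewrite lee_fin divr_ge0.
- under eq_fun do rewrite eE.
  exact: (measurable_fun_fin_valued mtab
    (fun a => (fdp (ebh_reject (fun i => m%:R * escore alpha a i) alpha) H0)%:E)).
- exact: measurable_funeM.
move=> w _; rewrite -EFinM lee_fin eE.
apply: le_trans (fdp_ebh_le _ a0 _) _.
  by move=> i; rewrite mulr_ge0// escore_ge0.
rewrite -mulr_sumr mulrA ler_wpM2r//; first by rewrite -lee_fin; exact: s0.
(* For [m = 0] the left side is 0 and the claim is [0 <= alpha]. *)
have [->|m0] := eqVneq (m%:R : R) 0; first by rewrite mulr0 ltW.
by rewrite divfK.
Qed.
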